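(* Let $\mathbb{B}$ be an infinite complete Boolean algebra, and suppose there exists an antichain $A$ in $\mathbb{B}$ with $2^{|A|}=|\mathbb{B}|$. Then there exist two Tukey-maximal ultrafilters $U$ and $V$ on $\mathbb{B}$ such that $U\not\le_\mathrm{JPR}V$ and $V\not\le_\mathrm{JPR}U$. (In particular $U$ and $V$ are Tukey-equivalent but JPR-incomparable.)
   Context: $\mathrm{Part}(\mathbb{B})$ denotes the set of maximal antichains of $\mathbb{B}$; $B$ refines $A$ if every element of $B$ lies below some element of $A$. JPR-ordering: for ultrafilters $U,V$ on a complete Boolean algebra $\mathbb{B}$, $U\le_\mathrm{JPR}V$ iff there exist $g\colon\mathrm{Part}(\mathbb{B})\to\mathrm{Part}(\mathbb{B})$ and, for each $A\in\mathrm{Part}(\mathbb{B})$, a function $f_A\colon g(A)\to A$ such that (1) for all $A\in\mathrm{Part}(\mathbb{B})$ and $X\subseteq A$: $\bigvee X\in U\iff\bigvee f_A^{-1}[X]\in V$; (2) whenever $B$ refines $A$ (both in $\mathrm{Part}(\mathbb{B})$), $\bigvee\{a\wedge b: a\in g(A), b\in g(B), f_B(b)\le f_A(a)\}\in V$. Tukey reducibility: $\langle U,\ge\rangle\le_\mathrm{T}\langle V,\ge\rangle$ iff there exist $f\colon U\to V$ and $g\colon V\to U$ with $v\le f(u)\Rightarrow g(v)\le u$ for all $u\in U,v\in V$. An ultrafilter $V$ on $\mathbb{B}$ is Tukey-maximal if $\langle U,\ge\rangle\le_\mathrm{T}\langle V,\ge\rangle$ for every ultrafilter $U$ on $\mathbb{B}$.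 *)

(* Defs.v *)
From HB Require Import structures.
From mathcomp Require Import all_boot all_order.
From mathcomp Require Import boolp classical_sets functions cardinality.
Set Implicit Arguments. Unset Strict Implicit. Unset Printing Implicit Defensive.
Import Order.TTheory.
Local Open Scope classical_set_scope.
Local Open Scope order_scope.

(* A Boolean algebra is a complemented distributive lattice with top and
   bottom (mathcomp's ctbDistrLatticeType). *)
Section BA.
Context {disp : Order.disp_t} {T : ctbDistrLatticeType disp}.

Definition complete_BA : Prop := forall X : set T, supremums X !=set0.

Definition bjoin (X : set T) : T := supremum \bot X.

Definition antichain (A : set T) : Prop :=
  (forall a, A a -> a != \bot) /\
  (forall a b, A a -> A b -> a <> b -> a `&` b = \bot).

Definition maximal_antichain (A : set T) : Prop :=
  antichain A /\ (forall B : set T, antichain B -> A `<=` B -> B = A).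

Definition refines (B A : set T) : Prop :=
  forall b, B b -> exists2 a, A a & b <= a.

Definition BA_filter (U : set T) : Prop :=
  U \top /\ ~ U \bot /\
  (forall a b, U a -> U b -> U (a `&` b)) /\
  (forall a b, U a -> a <= b -> U b).

Definition ultrafilter (U : set T) : Prop :=
  BA_filter U /\ (forall W : set T, BA_filter W -> U `<=` W -> W = U).

Definition Part := {A : set T | maximal_antichain A}.

Definition JPR_le (U V : set T) : Prop :=
  exists (g : Part -> Part)
         (f : forall A : Part, {x | proj1_sig (g A) x} -> {x | proj1_sig A x}),
    (forall (A : Part) (X : set T), X `<=` proj1_sig A ->
        (U (bjoin X) <->
         V (bjoin [set b | exists h : proj1_sig (g A) b,
                             X (proj1_sig (f A (exist _ b h)))]))) /\
    (forall A B : Part, refines (proj1_sig B) (proj1_sig A) ->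
        V (bjoin [set c | exists a b (ha : proj1_sig (g A) a)
                                     (hb : proj1_sig (g B) b),
                    proj1_sig (f B (exist _ b hb)) <=
                    proj1_sig (f A (exist _ a ha)) /\ c = a `&` b])).

(* Tukey reducibility of <U, >=> to <V, >=> *)
Definition tukey_le (U V : set T) : Prop :=
  exists (f : {u | U u} -> {v | V v}) (g : {v | V v} -> {u | U u}),
    forall u v, proj1_sig v <= proj1_sig (f u) -> proj1_sig (g v) <= proj1_sig u.

Definition tukey_maximal (V : set T) : Prop :=
  ultrafilter V /\ forall U, ultrafilter U -> tukey_le U V.

End BA.

(* Main.v *)
Require Import Defs.
From Stdlib Require Import Wellfounded.
From mathcomp Require Import all_boot all_order finmap.
From mathcomp Require Import boolp classical_sets functions cardinality.
From mathcomp Require Import wochoice.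
Set Implicit Arguments.
Unset Strict Implicit.
Unset Printing Implicit Defensive.
Import Order.TTheory Order.CTheory.
Local Open Scope classical_set_scope.
Local Open Scope card_scope.

(** Hausdorff's theorem gives [2^|A|] independent subsets of the antichain [A];
their joins form an independent family in the algebra [T], which is split into
two blocks of size [|T| = 2^|A|].  The first block generates, together with the
complements of the meets of its infinite subfamilies, a filter in which every
element lies below finitely many members of the block only.  Hence mapping the
elements of any ultrafilter [U] injectively into the block sends unbounded sets
to unbounded sets, and every ultrafilter extending that filter is Tukey-maximal.

The second block serves to build two such extensions [U true] and [U false] as
in Kunen's construction of incomparable ultrafilters.  Evaluated at a maximal
antichain containing [A], a reduction of [U (~~ b)] to [U b] yields [h : A -> T]
such that, for all [Y] included in [A], the join of [Y] is in [U (~~ b)] iff the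
join of [h @` Y] is in [U b].  There are only [2^|A|] pairs [(b, h)]; they are
defeated one at a time along a well-order of minimal type.  At each stage only
finitely many members of the block are spent: pick an unused member [Y], decide
the join of [h @` Y] in [U b] so that independence of the unused members is
kept, and decide the join of [Y] the opposite way in [U (~~ b)]. *)

(** * Well-orders and infinite cardinals *)

Lemma set_inj_card_le X Y (A : set X) (B : set Y) (f : X -> Y) :
  set_fun A B f -> set_inj A f -> A #<= B.
Proof.
move=> fAB fi; have /injfunPex[g] := ex_intro2 _ _ f fAB fi.
exact: inj_card_le.
Qed.

Lemma card_le_exinj X Y (A : set X) (B : set Y) : A !=set0 -> A #<= B ->
  exists2 f : X -> Y, set_fun A B f & set_inj A f.
Proof.
move=> [a Aa] /card_leP[f]; apply/injfunPex.
by squash (valLR (val (f (SigSub (mem_set Aa)))) f).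
Qed.

Lemma card_le_setTP X Y :
  [set: X] #<= [set: Y] <-> exists f : X -> Y, injective f.
Proof.
split=> [XY|[f fi]]; last by apply: set_inj_card_le (in2W fi).
have [[x]|nX] := pselect (inhabited X); last first.
  by exists (fun x => False_rect Y (nX (inhabits x))) => x; case: nX.
by have [|f _ fi] := card_le_exinj _ XY; [exists x|exists f; exact: in2TT].
Qed.

Lemma card_le_setX X Y X' Y' (A : set X) (B : set Y) (A' : set X')
    (B' : set Y') :
  A #<= A' -> B #<= B' -> A `*` B #<= A' `*` B'.
Proof.
have [->|/set0P[[x y] [Ax By]]] := eqVneq (A `*` B) set0; first by [].
move=> /card_le_exinj[|f fA fi]; first by exists x.
move=> /card_le_exinj[|g gB gi]; first by exists y.
apply: (@set_inj_card_le _ _ _ _ (fun p => (f p.1, g p.2))).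
  by move=> p [/fA ? /gB ?].
move=> [a b] [a' b'] /set_mem[/= Aa Bb] /set_mem[/= Aa' Bb'] [ff gg].
by congr (_, _); [apply: fi|apply: gi]; rewrite ?inE.
Qed.

Lemma finite_card_le_infinite X Y (A : set X) (B : set Y) :
  finite_set A -> infinite_set B -> A #<= B.
Proof.
by move=> /finite_set_countable AN /infiniteP; exact: card_le_trans.
Qed.

Lemma infinite_card_le X Y (A : set X) (B : set Y) :
  A #<= B -> infinite_set A -> infinite_set B.
Proof. by move=> AB; apply: contra_not; exact: card_le_finite. Qed.

Definition strict_well_order Q (lt : Q -> Q -> Prop) : Prop :=
  well_founded lt /\ forall x y, [\/ lt x y, x = y | lt y x].

Definition segment Q (lt : Q -> Q -> Prop) (q : Q) : set Q := [set x | lt x q].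

Definition initial_segment Q (lt : Q -> Q -> Prop) (S : set Q) : Prop :=
  forall q, S q -> segment lt q `<=` S.

Lemma strict_well_order_exists Q :
  exists lt : Q -> Q -> Prop, strict_well_order lt.
Proof.
have [R Rwo] := well_ordering_principle {classic Q}.
have Ranti := in2T (wo_chain_antisymmetric (withinW Rwo)).
have Rtot := in2T (wo_chainW (withinW Rwo)).
exists (fun x y => ~~ R y x); split=> [q|x y]; last first.
  have [yx|_] := boolP (R y x); last by constructor 1.
  have [xy|_] := boolP (R x y); last by constructor 3.
  by constructor 2; apply: Ranti; rewrite xy.
apply: contrapT => nq.
have [|z [[/asboolP zA zm] _]] :=
    Rwo [pred x | `[< ~ Acc (fun x y => ~~ R y x) x >]].
  by exists q; exact/asboolP.
apply: zA; split=> y /negP zy; apply: contrapT => ny.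
by apply: zy; apply: zm; exact/asboolP.
Qed.

Lemma strict_well_order_trans Q (lt : Q -> Q -> Prop) x y z :
  strict_well_order lt -> lt x y -> lt y z -> lt x z.
Proof.
move=> [wf tri].
have asym u v : lt u v -> ~ lt v u.
  by elim/(well_founded_ind wf): u v => u ih v uv vu; exact: (ih _ vu _ vu).
have acyclic u v w : lt u v -> lt v w -> ~ lt w u.
  elim/(well_founded_ind wf): u v w => u ih v w uv vw wu.
  exact: (ih _ wu _ _ wu uv).
move=> xy yz; have [//|xz|zx] := tri x z; last by case: (acyclic _ _ _ xy yz).
by rewrite xz in xy; case: (asym _ _ xy yz).
Qed.

Lemma segment_initial Q (lt : Q -> Q -> Prop) q :
  strict_well_order lt -> initial_segment lt (segment lt q).
Proof. by move=> swo y yq x xy; exact: strict_well_order_trans swo xy yq. Qed.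

Lemma strict_well_order_lexi Q Q' (lt : Q -> Q -> Prop) (lt' : Q' -> Q' -> Prop)
    (f : Q' -> Q) :
  strict_well_order lt -> strict_well_order lt' ->
  strict_well_order (fun x y => lt (f x) (f y) \/ f x = f y /\ lt' x y).
Proof.
move=> [wf tri] [wf' tri']; split=> [|x y].
  apply: wf_incl (wf_inverse_image _ _ _ (fun x => (f x, x)) _); last first.
    exact: wf_slexprod wf wf'.
  by move=> x y [fxy|[-> xy]]; constructor.
have [fxy|fxy|fyx] := tri (f x) (f y); first by constructor 1; left.
  have [xy|<-|yx] := tri' x y; first by constructor 1; right.
    by constructor 2.
  by constructor 3; right.
by constructor 3; left.
Qed.

Lemma wf_choice Q D (d0 : D) (lt : Q -> Q -> Prop)
    (P : Q -> set D -> D -> Prop) :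
  well_founded lt ->
  (forall q d, (forall y, lt y q -> P y (d @` segment lt y) (d y)) ->
    exists x, P q (d @` segment lt q) x) ->
  exists d, forall q, P q (d @` segment lt q) (d q).
Proof.
move=> wf Pex.
have /choice[pick pickP] (p : Q * set D) : exists x,
    (exists y, P p.1 p.2 y) -> P p.1 p.2 x.
  by have [[x Px]|] := pselect (exists y, P p.1 p.2 y); [exists x|exists d0].
pose step q (rec : forall y, lt y q -> D) :=
  pick (q, [set x | exists y (yq : lt y q), rec y yq = x]).
pose d := Fix wf (fun=> D) step.
have dE q : d q = pick (q, d @` segment lt q).
  rewrite /d Fix_eq => [|{}q f g fg].
    congr (pick (_, _)); apply/seteqP; split=> x.
      by move=> [y [yq <-]]; exists y.
    by move=> [y yq <-]; exists y, yq.
  by congr (step q); apply: functional_extensionality_dep => y; exact/funext/fg.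
exists d => q; elim/(well_founded_ind wf): q => q ih.
by rewrite dE; exact/(pickP (q, _))/Pex.
Qed.

Lemma card_le_of_segments Q Y (lt : Q -> Q -> Prop) (A : set Q) (B : set Y) :
  strict_well_order lt ->
  (forall q, A q -> ~ (B #<= A `&` segment lt q)) -> A #<= B.
Proof.
move=> [wf tri] small.
have [->|/set0P[q0 Aq0]] := eqVneq A set0; first exact: card_ge0.
have [B0|/set0P[y0 _]] := eqVneq B set0.
  by have := small _ Aq0; rewrite B0 card_ge0.
pose ltA x y := A x /\ lt x y.
have [||d dP] := @wf_choice _ _ y0 ltA (fun q E y => A q -> B y /\ ~ E y).
- by apply: wf_incl wf => x y [].
- move=> q d _; have [Aq|nAq] := pselect (A q); last by exists y0.
  have [y By nEy] : exists2 y, B y & ~ (d @` segment ltA q) y.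
    apply: contrapT => /forall2NP BE; apply: (small q Aq).
    apply: card_le_trans (card_image_le d _); apply: subset_card_le => y By.
    by apply: contrapT => nEy; case: (BE y).
  by exists y.
apply: (@set_inj_card_le _ _ _ _ d) => [q Aq|x y]; first by have [] := dP q Aq.
rewrite !inE => Ax Ay dxy; have [_ nx] := dP x Ax; have [_ ny] := dP y Ay.
have [xy|//|yx] := tri x y.
- by case: ny; exists x.
- by case: nx; exists y.
Qed.

Lemma card_le_setU1 X (A : set X) x :
  infinite_set A -> A `*` A #<= A -> x |` A #<= A.
Proof.
move=> iA; apply: card_le_trans.
have [a Aa] := infinite_setN0 iA.
have [b [Ab ba]] : A `\ a !=set0.
  by apply: infinite_setN0; apply: infinite_setD (finite_set1 _).
pose f y := if `[< y = x >] then (b, a) else (a, y).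
apply: (@set_inj_card_le _ _ _ _ f) => [y|y y' _ _]; rewrite /f.
  by case: asboolP => // yx [].
case: asboolP => [->|_]; case: asboolP => [->|_] // [] //.
by move=> /esym.
Qed.

Section Square.
Variables (X : Type) (lt : X -> X -> Prop) (lt2 : X * X -> X * X -> Prop).
Hypotheses (lt_swo : strict_well_order lt) (lt2_swo : strict_well_order lt2).

Let max (p : X * X) : X := if `[< lt p.1 p.2 >] then p.2 else p.1.

(* Goedel's ordering of pairs by their maximum. *)
Let lt_max p p' := lt (max p) (max p') \/ max p = max p' /\ lt2 p p'.

Let below q : set X := q |` segment lt q.

Let segment_lt_max p : segment lt_max p `<=` below (max p) `*` below (max p).
Proof.
have below_max p' : below (max p') p'.1 /\ below (max p') p'.2.
  rewrite /max; case: asboolP => [?|np]; first by split; [right|left].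
  split; first by left.
  by have [_ /(_ p'.1 p'.2)[|->|]] := lt_swo; [|left|right].
have below_trans q q' x : lt q q' -> below q x -> below q' x.
  move=> qq' [->|xq]; right=> //.
  exact: strict_well_order_trans lt_swo xq qq'.
move=> p' p'p; have [p1 p2] := below_max p'; case: p'p => [lt_mm|[<- _]] //.
by split; exact: below_trans lt_mm _.
Qed.

Lemma card_le_setX_initial_segment (A : set X) :
  initial_segment lt A ->
  (forall q, A q -> infinite_set (segment lt q) ->
     segment lt q `*` segment lt q #<= segment lt q) ->
  infinite_set A -> A `*` A #<= A.
Proof.
move=> Adown Asq iA.
have [[q Aq A_le]|A_nle] := pselect (exists2 q, A q & A #<= segment lt q).
  apply: card_le_trans (card_le_setX A_le A_le) _.
  apply: card_le_trans (subset_card_le (Adown q Aq)).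
  by apply: Asq => //; exact: infinite_card_le A_le iA.
have lt_max_swo : strict_well_order lt_max by exact: strict_well_order_lexi.
apply: (card_le_of_segments lt_max_swo) => p [Ap1 Ap2] A_le.
have Amax : A (max p) by rewrite /max; case: ifP.
have {}A_le : A #<= below (max p) `*` below (max p).
  apply: card_le_trans A_le (subset_card_le _) => p' [_]; exact: segment_lt_max.
have [fin|inf] := pselect (finite_set (segment lt (max p))).
  have fin_below : finite_set (below (max p)).
    by rewrite finite_setU; split; first exact: finite_set1.
  by apply: iA; apply: card_le_finite A_le _; exact: finite_setX.
have sq := Asq _ Amax inf; apply: A_nle; exists (max p) => //.
apply: (card_le_trans A_le); apply: (card_le_trans _ sq).
by apply: card_le_setX; exact: card_le_setU1.
Qed.

End Square.

Lemma card_le_prod_infinite X :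
  infinite_set [set: X] -> [set: X * X] #<= [set: X].
Proof.
have [lt lt_swo] := strict_well_order_exists X; have [wf _] := lt_swo.
have [lt2 lt2_swo] := strict_well_order_exists (X * X).
rewrite -setXTT; apply: (card_le_setX_initial_segment lt_swo lt2_swo) => // q _.
elim/(well_founded_ind wf): q => q ih.
apply: (card_le_setX_initial_segment lt_swo lt2_swo) => //.
exact: segment_initial.
Qed.

Lemma card_le_setX_infinite X (A : set X) : infinite_set A -> A `*` A #<= A.
Proof.
move=> iA; have A_T : A #<= [set: A] by rewrite (card_le_eqr (card_setT A)).
apply: card_le_trans (card_le_setX A_T A_T) _; rewrite setXTT.
rewrite -(card_le_eqr (card_setT A)); apply: card_le_prod_infinite.
exact: infinite_card_le A_T iA.
Qed.

Lemma card_le_bigcup X Y (E : set X) (F : X -> set Y) : infinite_set E ->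
  (forall x, E x -> F x #<= E) -> \bigcup_(x in E) F x #<= E.
Proof.
move=> iE FE; apply: card_le_trans (card_le_setX_infinite iE).
have [e Ee] := infinite_setN0 iE.
have /choice[f fP] x : exists f : Y -> X,
    E x -> set_fun (F x) E f /\ set_inj (F x) f.
  have [Fx0|/set0P Fx] := eqVneq (F x) set0.
    by exists (fun=> e) => _; rewrite Fx0; split=> y //; rewrite inE.
  have [Ex|nEx] := pselect (E x); last by exists (fun=> e).
  by have [g gF gi] := card_le_exinj Fx (FE x Ex); exists g.
have /choice[i iP] y : exists x, (\bigcup_(x in E) F x) y -> E x /\ F x y.
  by have [[x ? ?]|] := pselect ((\bigcup_(x in E) F x) y); [exists x|exists e].
apply: (@set_inj_card_le _ _ _ _ (fun y => (i y, f (i y) y))).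
  by move=> y /iP[Ei Fi]; have [/(_ y Fi)] := fP _ Ei.
move=> y y'; rewrite !inE => /iP[Ei Fi] /iP[_ Fi'] [ii]; rewrite -ii in Fi' *.
by have [_ fi] := fP _ Ei; apply: fi; rewrite inE.
Qed.

Lemma bigcup_finite_not_cover X Y (E : set X) (B : set Y) (F : X -> set Y) :
  (forall x, E x -> finite_set (F x)) -> infinite_set B -> ~ (B #<= E) ->
  exists2 y, B y & ~ (\bigcup_(x in E) F x) y.
Proof.
move=> Ffin iB BE; apply: contrapT => /forall2NP BF.
have {}BF : B #<= \bigcup_(x in E) F x.
  by apply: subset_card_le => y By; apply: contrapT => nFy; case: (BF y).
have [fE|iE] := pselect (finite_set E).
  by apply: iB; apply: card_le_finite BF _; exact: bigcup_finite.
apply: BE; apply: card_le_trans BF _; apply: card_le_bigcup => // x Ex.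
by apply: finite_card_le_infinite iE; exact: Ffin.
Qed.

Lemma card_le_bool_prod X :
  infinite_set [set: X] -> [set: bool * X] #<= [set: X].
Proof.
move=> iX; apply: card_le_trans (card_le_prod_infinite iX); rewrite -!setXTT.
apply: card_le_setX => //.
by apply: finite_card_le_infinite iX; exact: finite_finset.
Qed.

Lemma card_le_seq_infinite X :
  infinite_set [set: X] -> [set: seq X] #<= [set: X].
Proof.
move=> iX; have XX := card_le_prod_infinite iX.
have [x0 _] := infinite_setN0 iX; have /card_le_setTP[pair pair_inj] := XX.
have seq_le : [set: seq X] #<= [set: nat * X].
  pose code := foldr (fun x c => pair (x, c)) x0.
  apply/card_le_setTP; exists (fun s => (size s, code s)).
  elim=> [|x s ih] [|y t] // [sz] /pair_inj[-> code_st].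
  by rewrite (ih t) // sz code_st.
apply: card_le_trans seq_le (card_le_trans _ XX); rewrite -!setXTT.
by apply: card_le_setX => //; exact/infiniteP.
Qed.

Lemma finite_powerset X : finite_set [set: X] -> finite_set [set: set X].
Proof.
move=> finX; pose U : {fset {classic X}} := fset_set [set: {classic X}].
have finS (S : set {classic X}) : finite_set S by exact: sub_finite_set finX.
apply: (@sub_finite_set _ _
  ((fun F : {fset {classic X}} => [set` F]) @` [set` fpowerset U])).
  move=> S _; exists (fset_set S); last by rewrite fset_setK.
  by rewrite /= fpowersetE -fset_set_sub.
exact: finite_image (finite_fset _).
Qed.

Lemma card_le_powerset X Y :
  [set: X] #<= [set: Y] -> [set: set X] #<= [set: set Y].
Proof.
move=> /card_le_setTP[f fi]; apply/card_le_setTP.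
exists (image^~ f) => S S' fSS'; apply/funext => x.
rewrite -[S x](image_inj fi) -[S' x](image_inj fi).
exact: (congr1 (@^~ (f x)) fSS').
Qed.

Lemma card_le_fun_powerset X Y :
  infinite_set [set: X] -> [set: Y] #<= [set: set X] ->
  [set: X -> Y] #<= [set: set X].
Proof.
move=> iX /card_le_setTP[code code_inj].
apply: card_le_trans (card_le_powerset (card_le_prod_infinite iX)).
apply/card_le_setTP; exists (fun h => [set p | code (h p.1) p.2]) => h h' hh'.
apply/funext => x; apply/code_inj/funext => y.
exact: (congr1 (@^~ (x, y)) hh').
Qed.

Lemma card_powerset_type X (A : set X) : [set: set A] #= [set S | S `<=` A].
Proof.
pose val_image (S : set A) : set X := val @` S.
have val_image_inj : injective val_image.
  move=> S S' SS'; apply/funext => x.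
  rewrite -[S x](image_inj val_inj) -[S' x](image_inj val_inj).
  exact: (congr1 (@^~ (val x)) SS').
rewrite card_eq_sym; have <- : range val_image = [set S | S `<=` A].
  apply/seteqP; split=> [_ [S _ <-] _ [x _ <-]|S SA]; first exact: set_valP.
  exists (val @^-1` S) => //; apply/seteqP; split=> [_ [x Sx <-] //|x Sx].
  by exists (SigSub (mem_set (SA x Sx))).
exact: inj_card_eq (in2W val_image_inj).
Qed.

(** * Transfinite construction *)

Lemma initial_well_order_exists Q : exists lt : Q -> Q -> Prop,
  strict_well_order lt /\ forall q, ~ ([set: Q] #<= segment lt q).
Proof.
have [lt [wf tri]] := strict_well_order_exists Q.
have [[q0 q0_ge]|nge] := pselect (exists q, [set: Q] #<= segment lt q);
    last first.
  by exists lt; split=> // q Qq; apply: nge; exists q.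
have [q q_ge q_min] : exists2 q, [set: Q] #<= segment lt q &
    forall y, lt y q -> ~ ([set: Q] #<= segment lt y).
  elim/(well_founded_ind wf): q0 q0_ge => q ih q_ge.
  have [[y [yq y_ge]]|nge] :=
    pselect (exists y, lt y q /\ [set: Q] #<= segment lt y).
    exact: ih yq y_ge.
  by exists q => // y yq y_ge; apply: nge; exists y.
have [|f fq fi] := card_le_exinj _ q_ge; first by exists q.
exists (fun x y => lt (f x) (f y)); split.
  split; first exact: wf_inverse_image.
  move=> x y; have [xy|fxy|yx] := tri (f x) (f y); first by constructor 1.
    by constructor 2; apply: fi; rewrite ?inE.
  by constructor 3.
move=> y y_ge; apply: (q_min (f y)); first exact: fq.
apply: card_le_trans y_ge _; apply: (@set_inj_card_le _ _ _ _ f) => // x z _ _.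
by apply: fi; rewrite inE.
Qed.

Definition chain_closed D (good : set D -> Prop) : Prop :=
  forall F : set (set D), F `<=` good -> total_on F subset ->
    good (\bigcup_(E in F) E).

Lemma chain_closed_image Q D (lt : Q -> Q -> Prop) (good : set D -> Prop)
    (d : Q -> D) (S : set Q) :
  strict_well_order lt -> chain_closed good -> initial_segment lt S ->
  (forall q, S q -> good (d q |` d @` segment lt q)) -> good (d @` S).
Proof.
move=> lt_swo good_chain S_init S_good; have [_ tri] := lt_swo.
pose stage q := d q |` d @` segment lt q.
have -> : d @` S = \bigcup_(E in stage @` S) E.
  rewrite bigcup_image; apply/seteqP; split=> [_ [q Sq <-]|x [q Sq]].
    by exists q => //; left.
  by move=> [->|[y yq <-]]; [exists q|exists y => //; exact: S_init yq].
have stageS q q' : lt q q' -> stage q `<=` stage q'.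
  move=> qq' x [->|[y yq <-]]; right; first by exists q.
  by exists y => //; exact: strict_well_order_trans lt_swo yq qq'.
apply: good_chain => [_ [q Sq <-]|_ _ [q Sq <-] [q' Sq' <-]].
  exact: S_good.
by have [/stageS|->|/stageS] := tri q q'; [left|left|right].
Qed.

Lemma transfinite_extension Q D (d0 : D) (good : set D -> Prop)
    (meets : Q -> D -> Prop) :
  chain_closed good ->
  (forall q E, ~ ([set: Q] #<= E) -> good E ->
    exists2 x, good (x |` E) & meets q x) ->
  exists2 E, good E & forall q, exists2 x, E x & meets q x.
Proof.
move=> good_chain extend.
have [lt [lt_swo lt_init]] := initial_well_order_exists Q.
have [q d dP|d dP] := @wf_choice _ _ d0 lt
    (fun q E x => good (x |` E) /\ meets q x) lt_swo.1.
  have [||x gx mx] := extend q (d @` segment lt q); last by exists x.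
    move=> Qd; apply: (lt_init q).
    exact: card_le_trans Qd (card_image_le _ _).
  apply: (chain_closed_image lt_swo good_chain) => [|y /dP[]//].
  exact: segment_initial.
exists (range d); last by move=> q; exists (d q); have [] := dP q.
by apply: (chain_closed_image lt_swo good_chain) => // q _; have [] := dP q.
Qed.

(** * Independent families of sets *)

Definition independent_sets (I : eqType) K (Z : I -> set K) : Prop :=
  forall (e : I -> bool) (s : seq I),
    exists k, forall i, i \in s -> (Z i k <-> e i).

Definition trace I (K : eqType) (b : I -> set K) (F : seq K) (i : I) : seq K :=
  [seq x <- F | `[< b i x >]].

Lemma trace_inj_seq (I K : eqType) (x0 : K) (b : I -> set K) (s : seq I) :
  injective b -> exists F, {in s &, injective (trace b F)}.
Proof.
move=> b_inj.
have /choice[w wP] (p : I * I) :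
    exists x, p.1 <> p.2 -> ~ (b p.1 x <-> b p.2 x).
  have [->|pp] := pselect (p.1 = p.2); first by exists x0.
  apply: contrapT => /forallNP same; apply/pp/b_inj/funext => x.
  by apply/propext; apply: contrapT => xx; exact: (same x).
exists [seq w (i, j) | i <- s, j <- s] => i j si sj tr_ij.
apply: contrapT => /(wP (i, j)); apply => /=.
have wF : w (i, j) \in [seq w (i, j) | i <- s, j <- s] by exact: allpairs_f.
have := congr1 (fun l : seq K => w (i, j) \in l) tr_ij.
by rewrite /trace !mem_filter wF !andbT; exact: asbool_eq_equiv.
Qed.

(* A point of [K] codes a finite set [F] together with finitely many subsets of
   [F], and lies in [Z i] when the trace of [b i] on [F] is among them. *)
Lemma independent_sets_exist (I K : eqType) :
  infinite_set [set: K] -> [set: I] #<= [set: set K] ->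
  exists Z : I -> set K, independent_sets Z.
Proof.
move=> iK /card_le_setTP[b b_inj]; have [x0 _] := infinite_setN0 iK.
have seqK := card_le_seq_infinite iK.
have /card_le_setTP[code code_inj] : [set: seq K * seq (seq K)] #<= [set: K].
  apply: card_le_trans (card_le_prod_infinite iK); rewrite -!setXTT.
  apply: card_le_setX => //; apply: (card_le_trans _ seqK).
  have /card_le_setTP[f f_inj] := seqK.
  by apply/card_le_setTP; exists (map f); exact: inj_map.
exists (fun i => [set k | exists F L,
  k = code (F, L) /\ trace b F i \in L]) => e s.
have [F F_inj] := trace_inj_seq x0 s b_inj.
exists (code (F, [seq trace b F i | i <- s & e i])) => i si; split=> [|ei].
  move=> [_ [_ [/code_inj[<- <-]]]] /mapP[j].
  by rewrite mem_filter => /andP[ej sj] /(F_inj _ _ si sj) ->.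
by do 2 eexists; split; [reflexivity|apply: map_f; rewrite mem_filter ei].
Qed.

(** * Filters and independence in a Boolean algebra *)

Local Open Scope order_scope.

Section GeneratedFilter.
Context {disp : Order.disp_t} {T : ctbDistrLatticeType disp}.
Implicit Types (x y w : T) (G H U : set T) (l : seq T).

Definition generated_filter G : set T :=
  [set y | exists2 l, [set` l] `<=` G & \meet_(x <- l) x <= y].

Definition centered G : Prop := ~ generated_filter G \bot.

Lemma sub_generated_filter G : G `<=` generated_filter G.
Proof.
move=> x Gx; exists [:: x]; last by rewrite big_seq1.
by move=> y; rewrite /= inE => /eqP ->.
Qed.

Lemma generated_filter_up G x y :
  generated_filter G x -> x <= y -> generated_filter G y.
Proof. by move=> [l lG lx] xy; exists l => //; exact: le_trans xy. Qed.

Lemma generated_filterI G x y :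
  generated_filter G x -> generated_filter G y -> generated_filter G (x `&` y).
Proof.
move=> [l lG lx] [l' l'G l'y]; exists (l ++ l'); last by rewrite big_cat leI2.
by move=> z; rewrite /= mem_cat => /orP[/lG|/l'G].
Qed.

Lemma meet_seq_mem U l : U \top -> (forall x y, U x -> U y -> U (x `&` y)) ->
  [set` l] `<=` U -> U (\meet_(x <- l) x).
Proof.
move=> U1 UI lU; rewrite big_seq; apply: big_rec => // x y xl Uy.
by apply: UI => //; exact: lU.
Qed.

Lemma generated_filter_sub G H :
  G `<=` generated_filter H -> generated_filter G `<=` generated_filter H.
Proof.
move=> GH y [l lG ly]; apply: generated_filter_up ly; apply: meet_seq_mem.
- by exists [::]; rewrite ?big_nil.
- exact: generated_filterI.
- exact: subset_trans lG GH.
Qed.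

Lemma generated_filterS G H :
  G `<=` H -> generated_filter G `<=` generated_filter H.
Proof.
move=> GH; apply: generated_filter_sub.
exact: subset_trans GH (@sub_generated_filter H).
Qed.

Lemma generated_filter_of_filter U : BA_filter U -> generated_filter U `<=` U.
Proof.
by move=> [U1 [_ [UI Uup]]] y [l lU ly]; apply: Uup ly; exact: meet_seq_mem.
Qed.

Lemma generated_filter_BA_filter G :
  centered G -> BA_filter (generated_filter G).
Proof.
move=> cG; split; first by exists [::]; rewrite ?big_nil.
split=> //; split=> x y; first exact: generated_filterI.
exact: generated_filter_up.
Qed.

Lemma BA_filter_proper U x : BA_filter U -> U x -> ~ U (~` x).
Proof. by move=> [_ [U0 [UI _]]] Ux /(UI _ _ Ux); rewrite meetxC. Qed.

Definition signed (b : bool) x : T := if b then x else ~` x.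

Lemma BA_filter_signed U b x : BA_filter U -> U (signed b x) -> (U x <-> b).
Proof.
move=> fU; case: b => [Ux|/= Ucx]; split=> //.
by move=> /(BA_filter_proper fU).
Qed.

Lemma sub_centered G H : G `<=` generated_filter H -> centered H -> centered G.
Proof. by move=> /generated_filter_sub GH cH /GH. Qed.

Lemma centeredS G H : G `<=` H -> centered H -> centered G.
Proof. by move=> /generated_filterS GH cH /GH. Qed.

Lemma generated_filter_compl G w :
  ~ centered (w |` G) -> generated_filter G (~` w).
Proof.
move=> /contrapT[l lwG]; rewrite lex0 => /eqP l0.
exists [seq x <- l | x != w].
  by move=> x; rewrite /= mem_filter => /andP[/eqP xw /lwG[/xw|]].
rewrite -disj_leC -lex0 -l0; apply/meetsP_seq => x xl _.
have [->|xw] := eqVneq x w; first exact: leIr.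
by apply: le_trans (leIl _ _) _; apply: meets_inf_seq; rewrite ?mem_filter ?xw.
Qed.

Lemma generated_filter_bigcup J (D : set J) (F : J -> set T) :
  D !=set0 ->
  (forall i j, D i -> D j -> exists2 k, D k & F i `<=` F k /\ F j `<=` F k) ->
  generated_filter (\bigcup_(j in D) F j) `<=`
    \bigcup_(j in D) generated_filter (F j).
Proof.
move=> [j0 Dj0] Fdir y [l lF ly].
suff [j Dj lFj] : exists2 j, D j & [set` l] `<=` F j.
  by exists j => //; exists l.
elim: l lF {ly} => [|x l ih] lF; first by exists j0.
have [|j Dj lFj] := ih; first by move=> z zl; apply: lF; rewrite /= inE zl orbT.
have [i Di Fix] := lF x (mem_head _ _); have [k Dk [Fik Fjk]] := Fdir _ _ Di Dj.
exists k => // z; rewrite /= inE => /orP[/eqP ->|zl]; first exact: Fik.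
by apply: Fjk; exact: lFj.
Qed.

Lemma generated_filter_image (I : eqType) (f : I -> T) G (A : set I) y :
  generated_filter (G `|` f @` A)%classic y ->
  exists2 s : seq I, [set` s] `<=` A &
    generated_filter (G `|` f @` [set` s])%classic y.
Proof.
pose D := [set s : seq I | [set` s] `<=` A].
have sub : (G `|` f @` A `<=` \bigcup_(s in D) (G `|` f @` [set` s]))%classic.
  move=> x [Gx|[i Ai <-]]; first by exists [::] => //; left.
  exists [:: i]; first by move=> j; rewrite /= inE => /eqP ->.
  by right; exists i; rewrite /= ?mem_head.
move=> /(generated_filterS sub)/generated_filter_bigcup[||s sA Gs].
- by exists [::].
- move=> s t sA tA; exists (s ++ t).
    by move=> i; rewrite /= mem_cat => /orP[/sA|/tA].
  by split; apply: setUS; apply: image_subset => i /=;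
    rewrite mem_cat => ->; rewrite ?orbT.
- by exists s.
Qed.

Lemma centered_bigcup J (D : set J) (F : J -> set T) : D !=set0 ->
  total_on D (fun i j => F i `<=` F j) -> (forall j, D j -> centered (F j)) ->
  centered (\bigcup_(j in D) F j).
Proof.
move=> D0 Ftot Fc /(generated_filter_bigcup D0)[|j /Fc]; last exact.
move=> i j Di Dj; have [ij|ji] := Ftot _ _ Di Dj; first by exists j; last split.
by exists i; last split.
Qed.

Lemma exists_maximal_centered G : centered G ->
  exists M, [/\ G `<=` M, centered M &
    forall N, centered N -> M `<=` N -> N = M].
Proof.
move=> cG; have [F FG Ftot|M [cM Mmax]] :=
    @Zorn_bigcup _ [set M | centered (M `|` G)%classic].
  have [->|/set0P F0] := eqVneq F set0; first by rewrite /= bigcup_set0 set0U.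
  rewrite /= -bigcupUl //; apply: centered_bigcup => // M N FM FN.
  by have [MN|NM] := Ftot _ _ FM FN; [left|right]; exact: setSU.
have M_max N : centered (N `|` G)%classic -> M `<=` N -> N `<=` M.
  by move=> cN MN; apply: contrapT => NM; case: (Mmax N).
have GM : G `<=` M.
  move=> x Gx; apply: (M_max (M `|` G)%classic); [|exact: subsetUl|by right].
  by rewrite -setUA setUid.
rewrite /= (setUidl GM) in cM; exists M; split=> // N cN MN.
apply/seteqP; split=> //; apply: M_max => //.
by rewrite (setUidl (subset_trans GM MN)).
Qed.

Lemma centered_ultrafilter G :
  centered G -> exists2 U, ultrafilter U & G `<=` U.
Proof.
move=> /exists_maximal_centered[M [GM cM Mmax]]; exists M => //.
have fM : BA_filter M.
  rewrite -(Mmax (generated_filter M)); first exact: generated_filter_BA_filter.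
    by apply: sub_centered cM.
  exact: sub_generated_filter.
split=> // W fW; apply: Mmax => /(generated_filter_of_filter fW).
by case: fW => _ [].
Qed.

End GeneratedFilter.

Section Independence.
Context {disp : Order.disp_t} {T : ctbDistrLatticeType disp} {I : eqType}.
Variable X : I -> T.
Implicit Types (w : T) (G : set T) (R : set I) (e : I -> bool) (s : seq I).

Definition literals e R : set T := [set signed (e i) (X i) | i in R].

Definition independent_modulo G R : Prop :=
  forall e, centered (G `|` literals e (~` R))%classic.

Lemma sub_independent_modulo G G' R R' : G' `<=` G -> R `<=` R' ->
  independent_modulo G R -> independent_modulo G' R'.
Proof.
move=> GG RR Gind e; apply: centeredS (Gind e).
by apply: setUSS => //; apply: image_subset; exact: subsetC.
Qed.

Lemma independent_modulo_centered G R : independent_modulo G R -> centered G.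
Proof.
by move=> /(_ xpredT); apply: centeredS; exact: subsetUl.
Qed.

Lemma independent_modulo_bigcup J (D : set J) (G : J -> set T)
    (R : J -> set I) :
  D !=set0 -> total_on D (fun i j => G i `<=` G j) ->
  (forall j, D j -> independent_modulo (G j) (R j)) ->
  independent_modulo (\bigcup_(j in D) G j) (\bigcup_(j in D) R j).
Proof.
move=> D0 Gtot Gind e; rewrite -bigcupUl //; apply: centered_bigcup => //.
  by move=> i j Di Dj; case: (Gtot i j Di Dj); [left|right]; exact: setSU.
move=> j Dj; have GRj : independent_modulo (G j) (\bigcup_(j in D) R j).
  by apply: sub_independent_modulo (Gind j Dj) => //; exact: bigcup_sup.
exact: GRj.
Qed.

Lemma independent_modulo_literal G R i b : independent_modulo G R -> ~ R i ->
  independent_modulo (signed b (X i) |` G) (i |` R).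
Proof.
move=> Gind nRi e; pose e' j := if j == i then b else e j.
apply: centeredS (Gind e') => x [[->|Gx]|[j /not_orP[/eqP ji nRj] <-]].
- by right; exists i; rewrite // /e' eqxx.
- by left.
- by right; exists j; rewrite // /e' (negbTE ji).
Qed.

(* If adding [w] breaks independence, then finitely many literals refute [w];
   fixing their signs decides [~` w]. *)
Lemma independent_modulo_decide G R w : independent_modulo G R ->
  exists v s, independent_modulo (signed v w |` G) (R `|` [set` s])%classic.
Proof.
move=> Gind; have [wind|] := pselect (independent_modulo (w |` G) R).
  by exists true, [::]; apply: sub_independent_modulo wind.
move=> /existsNP[e]; rewrite -setUA => /generated_filter_compl.
move=> /generated_filter_image[s sR Gw]; exists false, s => e'.
pose e2 i := if i \in s then e i else e' i.
apply: sub_centered (Gind e2) => x [[->|Gx]|[i nRsi <-]].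
- apply: generated_filterS Gw; apply: setUS => _ [i si <-].
  by exists i; [exact: sR|rewrite /e2 si].
- by apply: sub_generated_filter; left.
- apply: sub_generated_filter; right; move: nRsi => /not_orP[nRi /negP nsi].
  by exists i => //; rewrite /e2 (negbTE nsi).
Qed.

Lemma independent_modulo_decide_opposite (G : bool -> set T) R i w c :
  (forall b, independent_modulo (G b) R) -> ~ R i ->
  exists v s (x : bool -> T),
    [/\ x c = signed v w, x (~~ c) = signed (~~ v) (X i) &
    forall b, independent_modulo (x b |` G b) (R `|` [set` s])%classic].
Proof.
move=> Gind nRi; have [v [s Gc]] := independent_modulo_decide w (Gind c).
exists v, (i :: s).
exists (fun b => if b == c then signed v w else signed (~~ v) (X i)).
split=> [||b /=]; [by rewrite eqxx|by case: c {Gc}|].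
case: eqP => [->|_].
  apply: sub_independent_modulo Gc => //; apply: setUS => j sj.
  by rewrite /= inE sj orbT.
have GX := independent_modulo_literal (b := ~~ v) (Gind b) nRi.
apply: sub_independent_modulo GX => //.
by move=> j [->|Rj]; [right; rewrite /= mem_head|left].
Qed.

Section OppositeDecisions.
Variables (W : Type) (w : W -> I -> T) (G0 : set T) (R0 : set I).
Hypothesis G0_ind : independent_modulo G0 R0.
Hypothesis fresh_inf : infinite_set (~` R0)%classic.
Hypothesis W_le : ([set: bool * W] #<= (~` R0)%classic)%card.

(* A stage [(x, s)] adds [x b] to the [b]-th filter and spends the indices in
   [s], which are given up in both filters. *)
Let stage : Type := (bool -> T) * seq I.
Implicit Types (E : set stage) (x : stage).

Let gens E b : set T := (G0 `|` [set x.1 b | x in E])%classic.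

Let used E : set I := (R0 `|` \bigcup_(x in E) [set` x.2])%classic.

Let good E : Prop := forall b, independent_modulo (gens E b) (used E).

Let decides (q : bool * W) x : Prop := exists i v,
  x.1 q.1 = signed v (w q.2 i) /\ x.1 (~~ q.1) = signed (~~ v) (X i).

Let good_chain_closed : chain_closed good.
Proof.
move=> F Fgood Ftot b; have [->|/set0P F0] := eqVneq F set0.
  apply: sub_independent_modulo G0_ind; last exact: subsetUl.
  by rewrite /gens bigcup_set0 image_set0 setU0.
have gens_used_ind : independent_modulo (\bigcup_(E in F) gens E b)
    (\bigcup_(E in F) used E).
  apply: independent_modulo_bigcup => // [E E' FE FE'|E FE]; last exact: Fgood.
  have [EE'|E'E] := Ftot _ _ FE FE'; [left|right];
    by apply: setUS; exact: image_subset.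
apply: sub_independent_modulo gens_used_ind; last first.
  move=> i [E FE [R0i|[x Ex ix]]]; first by left.
  by right; exists x => //; exists E.
move=> y [G0y|[x [E FE Ex] <-]]; last by exists E => //; right; exists x.
by have [E FE] := F0; exists E => //; left.
Qed.

Let good_extend q E : ~ ([set: bool * W] #<= E)%card -> good E ->
  exists2 x, good (x |` E) & decides q x.
Proof.
move=> small Egood.
have [|i nR0i ni] := bigcup_finite_not_cover (E := E)
  (fun x _ => finite_seq x.2) fresh_inf.
  by move=> E_ge; apply: small; exact: card_le_trans W_le E_ge.
have nused : ~ used E i by case.
have [v [s [x [xc xnc xind]]]] :=
  independent_modulo_decide_opposite (w q.2 i) q.1 Egood nused.
exists (x, s); last by exists i, v.
move=> b; apply: sub_independent_modulo (xind b).
  by rewrite /gens image_setU image_set1 setUCA.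
by rewrite /used bigcup_setU1 setUCA setUC.
Qed.

Lemma opposite_decisions : exists G : bool -> set T,
  [/\ forall b, G0 `<=` G b, forall b, centered (G b) &
  forall b h, exists i v,
    G b (signed v (w h i)) /\ G (~~ b) (signed (~~ v) (X i))].
Proof.
have [E Egood Edec] :=
  transfinite_extension ((fun=> \bot, [::]) : stage)
    good_chain_closed good_extend.
exists (gens E); split=> [b|b|b h]; first exact: subsetUl.
  exact: independent_modulo_centered (Egood b).
have [x Ex [i [v [xw xX]]]] := Edec (b, h).
by exists i, v; rewrite -xw -xX; split; right; exists x.
Qed.

End OppositeDecisions.
End Independence.

(** * Antichains, Tukey-maximality and the JPR-ordering *)

Section CompleteAlgebra.
Context {disp : Order.disp_t} {T : ctbDistrLatticeType disp}.
Hypothesis T_complete : @complete_BA disp T.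
Implicit Types (x y : T) (A S U V : set T).

Lemma bjoinP S : supremums S (bjoin S).
Proof.
rewrite /bjoin /supremum; case: ifPn => [/eqP ->|_].
  by split=> [x //|x _]; exact: le0x.
by case: xgetP => [x _ //|h]; have [x /h] := T_complete S.
Qed.

Lemma bjoin_ub S x : S x -> x <= bjoin S.
Proof. by have [ub _] := bjoinP S; exact: ub. Qed.

Lemma bjoin_le S y : (forall x, S x -> x <= y) -> bjoin S <= y.
Proof. by have [_ lub] := bjoinP S => Sy; exact: lub. Qed.

Lemma bjoin_disjoint S y :
  (forall x, S x -> x `&` y = \bot) -> bjoin S `&` y = \bot.
Proof.
move=> Sy; apply/eqP; rewrite disj_leC; apply: bjoin_le => x Sx.
by rewrite -disj_leC Sy.
Qed.

Definition bmeet S : T := ~` bjoin [set ~` x | x in S].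

Lemma bmeet_lb S x : S x -> bmeet S <= x.
Proof. by move=> Sx; rewrite -[leRHS]complK leC; apply: bjoin_ub; exists x. Qed.

Lemma bmeet_ge S y : (forall x, S x -> y <= x) -> y <= bmeet S.
Proof.
move=> yS; rewrite -[leLHS]complK leC; apply: bjoin_le => _ [x Sx <-].
by rewrite leC yS.
Qed.

Lemma maximal_antichain_extension A : antichain A ->
  exists2 A', maximal_antichain A' & A `<=` A'.
Proof.
move=> [A0 Ad]; pose c := ~` bjoin A.
pose A' := (A `|` [set x | x = c /\ c != \bot])%classic.
have A_c a : A a -> a `&` c = \bot.
  by move=> Aa; apply/eqP; rewrite disj_leC complK; exact: bjoin_ub.
exists A'; last exact: subsetUl.
split; first split=> [a|a b].
- by move=> [/A0//|[->]].
- move=> [Aa|[-> _]] [Ab|[-> _]] // ab; [exact: Ad|exact: A_c|].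
  by rewrite meetC; exact: A_c.
move=> B [B0 Bd] A'B; apply/seteqP; split=> // b Bb; apply: contrapT => nA'b.
have A'_b a : A' a -> a `&` b = \bot.
  by move=> A'a; apply: Bd => [|//|ab]; [exact: A'B|apply: nA'b; rewrite -ab].
have b_le_c : b <= c.
  rewrite -disj_leC meetC; apply/eqP/bjoin_disjoint => a Aa.
  by apply: A'_b; left.
have [c0|cN0] := eqVneq c \bot.
  by have := B0 _ Bb; rewrite -lex0 -c0 b_le_c.
by have := B0 _ Bb; rewrite -(meet_r b_le_c) A'_b ?eqxx //; right.
Qed.

Lemma JPR_le_join_hom A U V : antichain A -> JPR_le U V ->
  exists h : A -> T, forall Y : set A,
    U (bjoin (val @` Y)) <-> V (bjoin (h @` Y)).
Proof.
move=> /maximal_antichain_extension[A' maxA' AA'] [g [f [fP _]]].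
pose P : Part := exist _ A' maxA'.
pose fiber (S : set T) :=
  [set b | exists gb : sval (g P) b, S (sval (f P (exist _ b gb)))].
exists (fun k => bjoin (fiber [set val k])) => Y.
have -> : bjoin ((fun k : A => bjoin (fiber [set val k])) @` Y) =
    bjoin (fiber (val @` Y)).
  apply/le_anti/andP; split; apply: bjoin_le.
    move=> _ [k Yk <-]; apply: bjoin_le => b [gb fb].
    by apply: bjoin_ub; exists gb; exists k.
  move=> b [gb [k Yk fb]]; apply: le_trans (bjoin_ub _); last by exists k.
  by apply: bjoin_ub; exists gb.
by apply: (fP P) => _ [k _ <-]; apply: AA'; exact: set_valP.
Qed.

Lemma independent_modulo_antichain_joins (I : eqType) A (Z : I -> set A) :
  antichain A -> independent_sets Z ->
  independent_modulo (fun i => bjoin (val @` Z i)) set0 set0.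
Proof.
move=> [A0 Ad] Zind e /generated_filter_image[s _ [l lX]].
have [k kZ] := Zind e s; apply/negP; apply: contraTN (A0 _ (set_valP k)).
rewrite negbK -lex0; apply: le_trans; apply/meetsP_seq => x /lX[//|[i si <-]] _.
rewrite /signed; case: ifP => ei.
  by apply: bjoin_ub; exists k => //; exact/kZ.
rewrite -disj_leC meetC; apply/eqP/bjoin_disjoint => _ [k' Zk' <-].
apply: Ad; [exact: set_valP..|move=> /val_inj k'k].
by move: Zk'; rewrite k'k kZ // ei.
Qed.

Definition tukey_generators (I : Type) (X : I -> T) (B : set I) : set T :=
  (X @` B `|` [set (~` bmeet (X @` E))%O |
     E in [set E | infinite_set E /\ E `<=` B]])%classic.

Lemma independent_modulo_tukey_generators (I : eqType) (X : I -> T)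
    (B : set I) :
  independent_modulo X set0 set0 ->
  independent_modulo X (tukey_generators X B) B.
Proof.
move=> Xind e; rewrite -setUA setUC => /generated_filter_image[s sB].
pose e' i := if `[< B i >] then i \in s else e i.
apply: sub_centered (Xind e').
have lit i : generated_filter (set0 `|` literals X e' (~` set0))%classic
    (signed (e' i) (X i)).
  by apply: sub_generated_filter; right; exists i.
move=> x [[[E [iE EB] <-]|[i nBi <-]]|[i si <-]].
- have [i Ei nsi] : exists2 i, E i & ~ (i \in s).
    apply: contrapT => /forall2NP Es; apply: iE.
    apply: sub_finite_set (finite_seq s).
    by move=> i Ei; apply: contrapT => nsi; case: (Es i).
  apply: generated_filter_up (lit i) _; rewrite /e' (asboolT (EB _ Ei)).
  by rewrite (introF idP nsi) /= leC; apply: bmeet_lb; exists i.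
- by have := lit i; rewrite /e' (asboolF nBi).
- by have := lit i; rewrite /e' (asboolT (sB _ si)) si.
Qed.

Lemma tukey_generators_finite_above (I : Type) (X : I -> T) (B : set I) V v :
  BA_filter V -> tukey_generators X B `<=` V -> V v ->
  finite_set [set i | B i /\ v <= X i].
Proof.
move=> fV GV Vv; set above := [set i | _].
apply: contrapT => above_inf; have [_ [_ [_ Vup]]] := fV.
apply: (BA_filter_proper fV (x := bmeet (X @` above))).
  by apply: Vup Vv _; apply: bmeet_ge => _ [i [_ vi] <-].
by apply: GV; right; exists above => //; split=> // i [].
Qed.

Lemma tukey_maximal_of_generators (I : Type) (X : I -> T) (B : set I) V :
  ([set: T] #<= B)%card -> ultrafilter V -> tukey_generators X B `<=` V ->
  tukey_maximal V.
Proof.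
move=> T_le uV GV; split=> // U [fU _]; have [fV _] := uV.
have [f fB f_inj] := card_le_exinj (ex_intro _ \bot Logic.I) T_le.
have VX u : V (X (f u)) by apply: GV; left; exists (f u) => //; exact: fB.
have /choice[g gP] (v : {v | V v}) : exists u : {u | U u},
    forall u', U u' -> sval v <= X (f u') -> sval u <= u'.
  case: v => v Vv /=; pose above := [set u | U u /\ v <= X (f u)].
  have /finite_seqP[s above_s] : finite_set above.
    have := finite_preimage (sub_in2 _ f_inj)
      (tukey_generators_finite_above fV GV Vv).
    move=> /(_ (fun u _ => in_setT u)); apply: sub_finite_set => u [_ vu].
    by split=> //; exact: fB.
  have Us : U (\meet_(u <- s) u).
    have [U1 [_ [UI _]]] := fU; apply: meet_seq_mem => // u us.
    by have : above u by [rewrite above_s]; case.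
  exists (exist _ _ Us) => u Uu vu /=; apply: meets_inf_seq => //.
  by have : above u by []; rewrite above_s.
exists (fun u => exist _ (X (f (sval u))) (VX (sval u))), g => u v.
exact: gP (svalP u).
Qed.

Lemma tukey_maximal_JPR_incomparable (I : eqType) A (Z : I -> set A)
    (B : set I) :
  antichain A -> independent_sets Z ->
  ([set: T] #<= B)%card -> ([set: bool * (A -> T)] #<= (~` B)%classic)%card ->
  infinite_set (~` B)%classic ->
  exists U : bool -> set T,
    forall b, tukey_maximal (U b) /\ ~ JPR_le (U (~~ b)) (U b).
Proof.
move=> acA Zind T_le W_le inf_fresh; pose X i := bjoin (val @` Z i).
have Gind : independent_modulo X (tukey_generators X B) B.
  apply: independent_modulo_tukey_generators.
  exact: independent_modulo_antichain_joins.
pose w (h : A -> T) i := bjoin (h @` Z i).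
have [G [G0 Gc Gdec]] := opposite_decisions w Gind inf_fresh W_le.
have /choice[U UP] b : exists U, ultrafilter U /\ G b `<=` U.
  by have [U uU GU] := centered_ultrafilter (Gc b); exists U.
exists U => b; have [uU GU] := UP b; split.
  exact: tukey_maximal_of_generators T_le uU (subset_trans (G0 b) GU).
move=> /(JPR_le_join_hom acA)[h hP]; have [i [v [Gw GX]]] := Gdec b h.
have [[fU' _] GU'] := UP (~~ b); have [fU _] := uU.
have nv_v : ~~ v <-> v.
  apply: iff_trans (iff_sym (BA_filter_signed fU' (GU' _ GX))) _.
  exact: iff_trans (hP (Z i)) (BA_filter_signed fU (GU _ Gw)).
by case: (v) nv_v => -[nv_v v_nv]; [have := v_nv isT|have := nv_v isT].
Qed.

End CompleteAlgebra.

Theorem mainTheorem2 (disp : Order.disp_t) (T : ctbDistrLatticeType disp) :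
  @complete_BA disp T ->
  infinite_set [set: T] ->
  (exists A : set T, antichain A /\ ([set X | X `<=` A] #= [set: T])%card) ->
  exists U V : set T,
    tukey_maximal U /\ tukey_maximal V /\ ~ JPR_le U V /\ ~ JPR_le V U.
Proof.
move=> T_complete T_inf [A [acA]] /(card_eq_trans (card_powerset_type A)).
rewrite card_eq_le => /andP[setA_le T_le].
have A_inf : infinite_set [set: A].
  by move=> /finite_powerset; exact: infinite_card_le T_le T_inf.
have boolT_le := card_le_bool_prod T_inf.
have [Z Zind] := independent_sets_exist A_inf (card_le_trans boolT_le T_le).
pose block b : set (bool * T) := [set i | i.1 = b].
have T_le_block b : ([set: T] #<= block b)%card.
  by apply: (set_inj_card_le (f := pair b)) => // x y _ _ [].
have blockC : (~` block false)%classic = block true.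
  by apply/funext => -[[] x]; apply/propext; split=> // /(_ erefl).
have [||U UP] := tukey_maximal_JPR_incomparable T_complete acA Zind
  (T_le_block false).
- rewrite blockC; apply: card_le_trans (T_le_block true).
  apply: card_le_trans boolT_le; rewrite -!setXTT; apply: card_le_setX => //.
  exact: card_le_trans (card_le_fun_powerset A_inf T_le) setA_le.
- by rewrite blockC; exact: infinite_card_le (T_le_block true) T_inf.
have [[Ut nt] [Uf nf]] := (UP true, UP false).
by exists (U true), (U false).
Qed.
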